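(* Let $q$ be a prime power and $n\ge1$. A subset $\mathcal{U}\subseteq\mathbb{P}_q(n)$ is a distributive sublattice of the linear lattice $(\mathbb{P}_q(n),+,\cap)$ on which a complement function can be defined if and only if $\mathcal{U}$ is a linear code closed under intersection with $\mathbb{F}_q^n\in\mathcal{U}$.
   Context: $\mathbb{P}_q(n)$ is the set of all $\mathbb{F}_q$-subspaces of $\mathbb{F}_q^n$, a lattice under inclusion with join $X+Y$ and meet $X\cap Y$. The subspace distance is $d_S(X,Y)=\dim(X+Y)-\dim(X\cap Y)$. For $\mathcal{U}\subseteq\mathbb{P}_q(n)$ let $\mathcal{U}_k$ be its members of dimension $k$. A complement on $\mathcal{U}$ is a map $f:\mathcal{U}\to\mathcal{U}$ such that (i) $X\cap f(X)=\{0\}$ and $X\oplus f(X)=\mathbb{F}_q^n$ for all $X\in\mathcal{U}$; (ii) for each $0\le k\le n$ and each $X\in\mathcal{U}_k$, $f(X)$ is a uniquely determined element of $\mathcal{U}_{n-k}$; (iii) $f(f(X))=X$ for all $X$; (iv) $d_S(X,Y)=d_S(f(X),f(Y))$ for all $X,Y\in\mathcal{U}$. A subset $\mathcal{U}$ is a linear code if $\{0\}\in\mathcal{U}$ and there is $\boxplus:\mathcal{U}\times\mathcal{U}\to\mathcal{U}$ with $(\mathcal{U},\boxplus)$ an abelian group, $X\boxplus\{0\}=X$, $X\boxplus X=\{0\}$, and $d_S(X,Y)=d_S(X\boxplus W,Y\boxplus W)$ for all $X,Y,W\in\mathcal{U}$; it is closed under intersection if $X\cap Y\in\mathcal{U}$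 whenever $X,Y\in\mathcal{U}$. A distributive sublattice is a subset closed under $+$ and $\cap$ satisfying $X\cap(Y+Z)=(X\cap Y)+(X\cap Z)$. *)

(* Defs.v *)
From HB Require Import structures.
From mathcomp Require Import all_boot all_algebra.

Set Implicit Arguments.
Unset Strict Implicit.
Unset Printing Implicit Defensive.

Import GRing.Theory.
Local Open Scope ring_scope.

(* P_q(n), where q is the order of F: every prime power is the order of a
   finite field, unique up to isomorphism. *)
Notation projspace F n := {vspace 'rV[F]_n}.

Section ProjectiveSpace.
Variables (F : finFieldType) (n : nat).
Implicit Types (U : {pred projspace F n}) (X Y Z W : projspace F n).

(* The truncated subtraction is exact, as X :&: Y is a subspace of X + Y. *)
Definition subspace_dist X Y : nat := (\dim (X + Y)%VS - \dim (X :&: Y)%VS)%N.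

Definition layer U (k : nat) : {pred projspace F n} :=
  [pred X | (X \in U) && (\dim X == k)].

Definition closed_cap U : Prop := {in U &, forall X Y, (X :&: Y)%VS \in U}.
Definition closed_add U : Prop := {in U &, forall X Y, (X + Y)%VS \in U}.

(* A sublattice is nonempty, like any lattice; with the empty set allowed, the
   empty family would vacuously be complemented. *)
Definition distributive_sublattice U : Prop :=
  [/\ exists X, X \in U,
      closed_add U,
      closed_cap U &
      {in U & &, forall X Y Z, (X :&: (Y + Z) = X :&: Y + X :&: Z)%VS}].

(* Maps U -> U and U x U -> U are encoded as total functions on subspaces that
   preserve U; their values outside U are irrelevant. *)
Definition is_complement U (f : projspace F n -> projspace F n) : Prop :=
  [/\ {in U, forall X, f X \in U},
      {in U, forall X, (X :&: f X = 0)%VS /\ (X + f X = fullv)%VS},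
      forall k : nat, (k <= n)%N -> {in layer U k, forall X, f X \in layer U (n - k)%N},
      {in U, forall X, f (f X) = X} &
      {in U &, forall X Y, subspace_dist X Y = subspace_dist (f X) (f Y)}].

Definition abelian_group_on U
    (op : projspace F n -> projspace F n -> projspace F n) : Prop :=
  [/\ {in U &, forall X Y, op X Y \in U},
      {in U & &, forall X Y Z, op X (op Y Z) = op (op X Y) Z},
      {in U &, forall X Y, op X Y = op Y X} &
      exists2 E, E \in U &
        {in U, forall X, op X E = X} /\
        {in U, forall X, exists2 Y, Y \in U & op X Y = E}].

Definition linear_code U : Prop :=
  0%VS \in U /\
  exists op : projspace F n -> projspace F n -> projspace F n,
    [/\ abelian_group_on U op,
        {in U, forall X, op X 0%VS = X},
        {in U, forall X, op X X = 0%VS} &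
        {in U & &, forall X Y W,
           subspace_dist X Y = subspace_dist (op X W) (op Y W)}].

End ProjectiveSpace.

(* Main.v *)
(** In a code with group law [[+]] that is closed under intersection,
    translation invariance of the distance gives
    [dim (X [+] Y) = dim (X + Y) - dim (X :&: Y)].  Hence [X [+] Y] is [X + Y]
    when [X] and [Y] are disjoint, and is a complement of [Y] in [X] when
    [Y <= X].  So sums of codewords are codewords, [X |-> V [+] X] is a
    complement, and distributivity follows from modularity together with the
    cancellation law of the group.  Conversely, a complemented distributive
    sublattice is a Boolean algebra; its symmetric difference is a group law for
    which the distance of [X] and [Y] is the dimension of their sum, hence
    translation invariant. *)
Require Import Defs.
From HB Require Import structures.
From mathcomp Require Import all_boot all_algebra.
From mathcomp Require Import ssrAC zify.

(** * Complemented distributive sublattices are linear codes *)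

Section BooleanToCode.
Variables (F : finFieldType) (n : nat) (U : {pred projspace F n}).
Variable f : projspace F n -> projspace F n.
Hypothesis latU : distributive_sublattice U.
Hypothesis complU : is_complement U f.
Local Open Scope vspace_scope.
Implicit Types X Y Z W : projspace F n.

Let memD X Y : X \in U -> Y \in U -> X + Y \in U.
Proof. by case: latU => _ + _ _; apply. Qed.

Let memI X Y : X \in U -> Y \in U -> X :&: Y \in U.
Proof. by case: latU => _ _ + _; apply. Qed.

Let memC X : X \in U -> f X \in U.
Proof. by case: complU => + _ _ _ _; apply. Qed.

Let memE := (memD, memI, memC).

Let capDr X Y Z : X \in U -> Y \in U -> Z \in U ->
  X :&: (Y + Z) = X :&: Y + X :&: Z.
Proof. by case: latU => _ _ _; apply. Qed.

Let capDl X Y Z : X \in U -> Y \in U -> Z \in U ->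
  (Y + Z) :&: X = Y :&: X + Z :&: X.
Proof. by move=> XU YU ZU; rewrite capvC capDr // ![X :&: _]capvC. Qed.

Let capC X : X \in U -> X :&: f X = 0.
Proof. by case: complU => _ H _ _ _ /H[]. Qed.

Let addC X : X \in U -> X + f X = fullv.
Proof. by case: complU => _ H _ _ _ /H[]. Qed.

Lemma complement_0fullv : 0 \in U /\ fullv \in U.
Proof.
have [[X XU] _ _ _] := latU.
by rewrite -(capC _ XU) -(addC _ XU) !memE.
Qed.

(** Distributing [Y] over [X + f X] and [f X] over [X + Y] shows that both equal [f X :&: Y]. *)
Lemma complement_unique X Y : X \in U -> Y \in U ->
  X :&: Y = 0 -> X + Y = fullv -> f X = Y.
Proof.
move=> XU YU capXY addXY.
have YfX : Y :&: f X = Y.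
  by rewrite -[RHS]capvf -(addC _ XU) capDr ?memE // [Y :&: X]capvC capXY add0v.
rewrite -[RHS]YfX -[LHS]capvf -addXY capDr ?memE //.
by rewrite [f X :&: X]capvC capC // add0v capvC.
Qed.

(** Symmetric difference in the Boolean algebra with complement [f]. *)
Definition boolean_sum X Y := X :&: f Y + Y :&: f X.
Local Notation "X <+> Y" := (boolean_sum X Y) (at level 50, left associativity).

Lemma boolean_sum_mem X Y : X \in U -> Y \in U -> X <+> Y \in U.
Proof. by move=> XU YU; rewrite /boolean_sum !memE. Qed.

Lemma boolean_sumC X Y : X <+> Y = Y <+> X.
Proof. by rewrite /boolean_sum addvC. Qed.

Lemma boolean_sum0 X : X \in U -> X <+> 0 = X.
Proof.
move=> XU; have [U0 _] := complement_0fullv.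
(* Here [f 0 = 0 + f 0 = fullv]. *)
by rewrite /boolean_sum -[f 0]add0v addC // capvf cap0v addv0.
Qed.

Lemma boolean_sumvv X : X \in U -> X <+> X = 0.
Proof. by move=> XU; rewrite /boolean_sum capC // addv0. Qed.

Lemma split_complement X Y : X \in U -> Y \in U ->
  X :&: Y + X :&: f Y = X.
Proof. by move=> XU YU; rewrite -capDr ?memE // addC // capvf. Qed.

(** By uniqueness it suffices to test the candidate: every cross meet contains an element together
    with its complement, and the four terms regroup to [X + f X]. *)
Lemma complement_boolean_sum X Y : X \in U -> Y \in U ->
  f (X <+> Y) = X :&: Y + f X :&: f Y.
Proof.
move=> XU YU; apply: complement_unique; rewrite ?boolean_sum_mem ?memE //.
  rewrite /boolean_sum capDr ?capDl ?memE //.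
  rewrite [X :&: f Y :&: (X :&: Y)](capv.[AC (2*2) ((1*3)*(4*2))]).
  rewrite [Y :&: f X :&: (X :&: Y)](capv.[AC (2*2) ((3*2)*(1*4))]).
  rewrite [X :&: f Y :&: (f X :&: f Y)](capv.[AC (2*2) ((1*3)*(2*4))]).
  rewrite [Y :&: f X :&: (f X :&: f Y)](capv.[AC (2*2) ((1*4)*(3*2))]).
  by rewrite !capC // !cap0v !capv0 !addv0.
rewrite /boolean_sum (addv.[AC (2*2) ((3*1)*(2*4))]) split_complement //.
by rewrite [Y :&: _]capvC split_complement ?memE // addC.
Qed.

(** Both sides expand to the sum of the four triple meets with an even number of complemented
    factors. *)
Lemma boolean_sumA X Y Z : X \in U -> Y \in U -> Z \in U ->
  X <+> (Y <+> Z) = X <+> Y <+> Z.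
Proof.
move=> XU YU ZU; rewrite {1}/boolean_sum [RHS]/boolean_sum.
rewrite !complement_boolean_sum // /boolean_sum !capDr ?capDl ?memE //.
rewrite (addv.[AC (2*2) ((2*3)*(1*4))]) !capvA.
rewrite [Y :&: f Z :&: f X](capv.[ACl 1*3*2]).
rewrite [Z :&: f Y :&: f X](capv.[ACl 1*3*2]).
by rewrite [Z :&: X :&: Y](capv.[ACl 2*3*1]).
Qed.

(** [X] is the direct sum of [X :&: Y] and [X :&: f Y], and likewise for [Y]; both dimensions are
    [\dim X + \dim Y - 2 * \dim (X :&: Y)]. *)
Lemma subspace_dist_boolean_sum X Y : X \in U -> Y \in U ->
  subspace_dist X Y = \dim (X <+> Y).
Proof.
move=> XU YU; rewrite /subspace_dist /boolean_sum.
have cap0 A B : A \in U -> B \in U -> A :&: B :&: (A :&: f B) = 0.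
  by move=> AU BU; rewrite (capv.[AC (2*2) ((1*3)*(2*4))]) capC // capv0.
have dimE A B : A \in U -> B \in U ->
    \dim A = (\dim (A :&: B) + \dim (A :&: f B))%N.
  by move=> AU BU; rewrite -(dimv_disjoint_sum (cap0 A B AU BU)) split_complement.
have dimXY := dimE _ _ XU YU; have := dimE _ _ YU XU.
rewrite [Y :&: X]capvC [\dim (_ :&: f Y + _)]dimv_disjoint_sum; last first.
  by rewrite (capv.[AC (2*2) ((1*4)*(3*2))]) !capC // capv0.
have := dimv_sum_cap X Y; lia.
Qed.

Lemma complemented_linear_code : linear_code U.
Proof.
have [U0 U1] := complement_0fullv.
split=> //; exists boolean_sum; split.
- split.
  + by move=> X Y; apply: boolean_sum_mem.
  + by move=> X Y Z; apply: boolean_sumA.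
  + by move=> X Y _ _; apply: boolean_sumC.
  + exists 0 => //; split=> X XU; first exact: boolean_sum0.
    by exists X => //; apply: boolean_sumvv.
- exact: boolean_sum0.
- exact: boolean_sumvv.
move=> X Y W XU YU WU.
rewrite !subspace_dist_boolean_sum ?boolean_sum_mem //; congr (\dim _).
rewrite [Y <+> W]boolean_sumC boolean_sumA ?boolean_sum_mem //.
by rewrite -[X <+> W <+> W]boolean_sumA // boolean_sumvv // boolean_sum0.
Qed.

End BooleanToCode.

(** * Linear codes closed under intersection are complemented distributive sublattices *)

Section CodeToBoolean.
Variables (F : finFieldType) (n : nat) (U : {pred projspace F n}).
Variable op : projspace F n -> projspace F n -> projspace F n.
Hypothesis U0 : (0%VS : projspace F n) \in U.
Hypothesis U1 : (fullv : projspace F n) \in U.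
Hypothesis memI : closed_cap U.
Hypothesis groupU : abelian_group_on U op.
Hypothesis op0 : {in U, forall X, op X 0%VS = X}.
Hypothesis opvv : {in U, forall X, op X X = 0%VS}.
Hypothesis dist_op : {in U & &, forall X Y W,
  subspace_dist X Y = subspace_dist (op X W) (op Y W)}.
Local Open Scope vspace_scope.
Implicit Types X Y Z W : projspace F n.

Let memO X Y : X \in U -> Y \in U -> op X Y \in U.
Proof. by case: groupU => + _ _ _; apply. Qed.

Let opA X Y Z : X \in U -> Y \in U -> Z \in U -> op X (op Y Z) = op (op X Y) Z.
Proof. by case: groupU => _ + _ _; apply. Qed.

Let opC X Y : X \in U -> Y \in U -> op X Y = op Y X.
Proof. by case: groupU => _ _ + _; apply. Qed.

Lemma code_opK X Y : X \in U -> Y \in U -> op (op X Y) Y = X.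
Proof. by move=> XU YU; rewrite -opA // opvv // op0. Qed.

Lemma code_opKl X Y : X \in U -> Y \in U -> op X (op X Y) = Y.
Proof. by move=> XU YU; rewrite [op X Y]opC // opC ?memO // code_opK. Qed.

(** Translation by [Y] turns the distance from [X] to [Y] into that from [op X Y] to [0]. *)
Lemma dim_code_op X Y : X \in U -> Y \in U ->
  (\dim (op X Y) + 2 * \dim (X :&: Y) = \dim X + \dim Y)%N.
Proof.
move=> XU YU; have := dist_op _ _ _ XU YU YU.
rewrite opvv // /subspace_dist addv0 capv0 dimv0 subn0 => <-.
have := dimv_sum_cap X Y; have := dimvS (capvSl X Y).
have := dimvS (addvSl X Y); lia.
Qed.

Lemma code_op_disjoint X Y : X \in U -> Y \in U -> X :&: Y = 0 ->
  op X Y = X + Y.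
Proof.
move=> XU YU XY0; have dimXY := dim_code_op _ _ XU YU.
rewrite XY0 dimv0 in dimXY.
have subO A B : A \in U -> B \in U -> \dim (op A B) = (\dim A + \dim B)%N ->
    A <= op A B.
  (* As [op A (op A B) = B], the dimension formula gives [A :&: op A B] the dimension of [A]. *)
  move=> AU BU dimAB; have := dim_code_op _ _ AU (memO _ _ AU BU).
  rewrite code_opKl // dimAB => dimA; apply/capv_idPl/eqP.
  by rewrite eqEdim capvSl /=; lia.
apply/esym/eqP; rewrite eqEdim dimv_disjoint_sum // subv_add subO //=; last by lia.
rewrite {1}opC // subO //=; first by lia.
by rewrite opC //; lia.
Qed.

(** The dimension formula for [X, Y] and for [op X Y, Y] forces a zero meet; on disjoint codewords
    [op] is the sum. *)
Lemma code_op_sub X Y : X \in U -> Y \in U -> Y <= X ->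
  Y :&: op X Y = 0 /\ Y + op X Y = X.
Proof.
move=> XU YU sYX; have OU := memO _ _ XU YU.
have dimXY := dim_code_op _ _ XU YU; rewrite (capv_idPr sYX) in dimXY.
have := dim_code_op _ _ OU YU; rewrite code_opK // => dimOY.
have YO0 : Y :&: op X Y = 0.
  by rewrite capvC; apply/eqP; rewrite -dimv_eq0; have := dimvS sYX; lia.
by split; rewrite // -code_op_disjoint // opC // code_opK.
Qed.

(** Makes a sum direct: [Z] is the complement of [X :&: Y] in [Y]. *)
Lemma code_addv_split X Y : X \in U -> Y \in U ->
  exists Z, [/\ Z \in U, Z <= Y, X :&: Z = 0 & X + Z = X + Y].
Proof.
move=> XU YU; have XYU := memI _ _ XU YU.
have [cap0 addE] := code_op_sub _ _ YU XYU (capvSr X Y).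
set Z := op Y (X :&: Y) in cap0 addE; have sZY : Z <= Y by rewrite -addE addvSr.
exists Z; split=> //; first exact: memO.
  by rewrite -(capv_idPr sZY) capvA.
by rewrite -[in RHS]addE addvA (addv_idPl (capvSl X Y)).
Qed.

Lemma code_closed_add : closed_add U.
Proof.
move=> X Y XU YU; have [Z [ZU _ XZ0 <-]] := code_addv_split _ _ XU YU.
by rewrite -code_op_disjoint // memO.
Qed.

(* By modularity [C + A = A + D] with [D := (C + A) :&: B], so cancellation of
   [A] in [op C A = op D A] gives [C = D <= B]. *)
Lemma code_no_diamond A B C : A \in U -> B \in U -> C \in U ->
  A :&: B = 0 -> C :&: A = 0 -> C :&: B = 0 -> C <= A + B -> C = 0.
Proof.
move=> AU BU CU AB0 CA0 CB0 sC.
set D := B :&: (C + A).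
have DU : D \in U by rewrite memI ?code_closed_add.
have DA0 : D :&: A = 0.
  by apply/eqP; rewrite -subv0 -AB0 capvC capvS // capvSl.
have DAE : D + A = C + A.
  rewrite addvC vspace_modl ?addvSr //; apply/capv_idPr.
  by rewrite subv_add sC addvSl.
have CD : C = D.
  rewrite -(code_opK C A) // [op C A]code_op_disjoint // -DAE.
  by rewrite -code_op_disjoint // code_opK.
by rewrite -CB0; apply/esym/capv_idPl; rewrite CD capvSl.
Qed.

(** The complement [op X W] of [W] in [X] meets [A] and [B] trivially yet lies in [A + B], so it
    vanishes. *)
Lemma code_distr_disjoint X A B : X \in U -> A \in U -> B \in U ->
  A :&: B = 0 -> X <= A + B -> X = X :&: A + X :&: B.
Proof.
move=> XU AU BU AB0 sX; set W := X :&: A + X :&: B.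
have WU : W \in U by rewrite code_closed_add ?memI.
have sWX : W <= X by rewrite subv_add !capvSl.
have [cap0 addE] := code_op_sub _ _ XU WU sWX.
have CU : op X W \in U by rewrite memO.
have sCX : op X W <= X by rewrite -[X in _ <= X]addE addvSr.
have capC0 D : X :&: D <= W -> op X W :&: D = 0.
  move=> sD; apply/eqP; rewrite -subv0 -cap0 subv_cap capvSl andbT.
  by rewrite (subv_trans _ sD) ?capvS.
have C0 : op X W = 0.
  apply: (code_no_diamond A B) => //; last exact: subv_trans sX.
    by rewrite capC0 // /W addvSl.
  by rewrite capC0 // /W addvSr.
by rewrite -[LHS]addE C0 addv0.
Qed.

Lemma code_distributive_sublattice : distributive_sublattice U.
Proof.
split; [by exists 0 | exact: code_closed_add | exact: memI |].
move=> X Y Z XU YU ZU; apply/eqP; rewrite eqEsubv; apply/andP; split; last first.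
  by rewrite subv_add !capvS ?addvSl ?addvSr.
(* Replacing [Z] by [A <= Z] reduces to the disjoint case. *)
have [A [AU sAZ YA0 <-]] := code_addv_split _ _ YU ZU.
rewrite [X in X <= _](code_distr_disjoint _ Y A) ?capvSr ?memI //;
  last by rewrite code_closed_add.
by apply: addvS; rewrite -capvA capvS // (subv_trans (capvSr _ _)).
Qed.

Lemma code_complement : is_complement U (op fullv).
Proof.
split.
- by move=> X XU; rewrite memO.
- by move=> X XU; apply: code_op_sub; rewrite ?subvf.
- move=> k _ X /andP[XU /eqP dimX]; apply/andP; split; first exact: memO.
  have := dim_code_op _ _ U1 XU.
  (* The dimension of the row space unfolds to [1 * n]. *)
  by rewrite (capv_idPr (subvf X)) dimvf /dim /= mul1n; lia.
- by move=> X XU; rewrite code_opKl.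
(* This is translation by [fullv]. *)
by move=> X Y XU YU; rewrite ![op fullv _]opC //; apply: dist_op.
Qed.

End CodeToBoolean.

Theorem theorem11 (F : finFieldType) (n : nat) (hn : (1 <= n)%N)
    (U : {pred projspace F n}) :
  (distributive_sublattice U /\
   exists f : projspace F n -> projspace F n, is_complement U f)
  <->
  (linear_code U /\ closed_cap U /\ (fullv : projspace F n) \in U).
Proof.
split=> [[latU [f complU]] | [[U0 [op [groupU op0 opvv dist_op]]] [memI U1]]].
  have [_ U1] := complement_0fullv _ _ _ _ latU complU.
  have codeU := complemented_linear_code _ _ _ _ latU complU.
  by case: latU => _ _ memI _.
split; first exact: (code_distributive_sublattice _ _ _ op).
by exists (op fullv); apply: code_complement.
Qed.
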